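(* Let $t\ge 1$ be an integer, let $r=2t$, let $K$ be a field, let $R=K[X_1,\dots,X_{3t+3}]$, and let $\mathcal{I}\subset R$ be the edge ideal of the graph $B_{2t}$. Then the projective dimension $\operatorname{pd}_R(R/\mathcal{I})$ satisfies: 1) $\frac{3}{4}r+\frac{3}{2}<\operatorname{pd}_R(R/\mathcal{I})\le \frac{3}{2}r+3$ if $t$ is odd; 2) $\frac{3}{4}r+1<\operatorname{pd}_R(R/\mathcal{I})\le \frac{3}{2}r+3$ if $t$ is even.
   Context: For an integer $t\ge 1$, $B_{2t}$ is the simple graph with vertex set $\{v_1,\dots,v_{3t+3}\}$ and edge set $\{\{v_i,v_{i+1}\} : 1\le i\le 3t+2,\ i\ne t+1,\ i\neq 2t+2\}\cup\{\{v_i,v_{i+t+1}\} : 1\le i\le 2t+2\}$ (a grid of unit squares with 2 rows and $t$ columns of squares); $r=2t$ is its number of (bounded) regions. The edge ideal of a graph on $v_1,\dots,v_n$ is the ideal of $K[X_1,\dots,X_n]$ generated by all monomials $X_iX_j$ with $\{v_i,v_j\}$ an edge. *)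

(* Defs.v *)
From HB Require Import structures.
From mathcomp Require Import all_boot all_order all_algebra.
From mathcomp Require Import boolp.
From mathcomp Require Import mpoly.

Set Implicit Arguments.
Unset Strict Implicit.
Unset Printing Implicit Defensive.

Import GRing.Theory.

Local Open Scope ring_scope.
Local Open Scope quotient_scope.

Definition projective_module (A : nzRingType) (P : lmodType A) : Prop :=
  forall (M N : lmodType A) (g : {linear M -> N}) (f : {linear P -> N}),
    (forall y, exists x, g x = y) ->
    exists h : {linear P -> M}, forall x, g (h x) = f x.

(* 0 -> P_n -> ... -> P_1 -> P_0 -> M -> 0 is exact, every P_i is projective;
   the complex is indexed by all of nat and vanishes above degree n. *)
Definition has_projective_resolution
    (A : nzRingType) (M : lmodType A) (n : nat) : Prop :=
  exists (P : nat -> lmodType A)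
         (d : forall i, {linear P i.+1 -> P i})
         (aug : {linear P 0%N -> M}),
    [/\ forall i, projective_module (P i),
        forall y, exists x, aug x = y,
        forall x, aug x = 0 <-> exists z, d 0%N z = x,
        forall i x, d i x = 0 <-> exists z, d i.+1 z = x
      & forall i, (n < i)%N -> forall x : P i, x = 0].

(* pd_A(M) = n for a natural number n; no n satisfies this when pd_A(M) is
   infinite.  Convention: the zero module gets n = 0. *)
Definition is_projective_dimension
    (A : nzRingType) (M : lmodType A) (n : nat) : Prop :=
  has_projective_resolution M n /\
  forall m, has_projective_resolution M m -> (n <= m)%N.

Section QuotientModule.
Variables (A : nzRingType) (V : lmodType A) (S : {pred V}).
Hypothesis S_closed : submod_closed S.

Let I : zmodClosed V :=
  HB.pack (S : V -> bool)
    (GRing.isZmodClosed.Build V S (GRing.submod_closedB S_closed)).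

Definition quotient_module : Type := {ideal_quot I}.

HB.instance Definition _ := GRing.Zmodule.on quotient_module.
HB.instance Definition _ := EqQuotient.on quotient_module.

Definition quotient_scale (a : A) (x : quotient_module) : quotient_module :=
  \pi_({ideal_quot I}) (a *: repr x).

Lemma pi_quotient_scale (a : A) (v : V) :
  quotient_scale a (\pi_({ideal_quot I}) v) = \pi_({ideal_quot I}) (a *: v).
Proof.
apply/eqP; rewrite /quotient_scale -Quotient.idealrBE -scalerBr.
apply: (GRing.subsemimod_closedZ (GRing.submod_closed_semi S_closed)).
have: repr (\pi_({ideal_quot I}) v) - v \in I by rewrite Quotient.idealrBE reprK.
by [].
Qed.

Lemma quotient_moduleP (x : quotient_module) :
  exists v : V, x = \pi_({ideal_quot I}) v.
Proof. by exists (repr (x : {ideal_quot I})); rewrite reprK. Qed.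

Fact quotient_scaleA a b x :
  quotient_scale a (quotient_scale b x) = quotient_scale (a * b) x.
Proof. by have [v ->] := quotient_moduleP x; rewrite !pi_quotient_scale scalerA. Qed.

Fact quotient_scale1 : left_id 1 quotient_scale.
Proof.
by move=> x; have [v ->] := quotient_moduleP x; rewrite pi_quotient_scale scale1r.
Qed.

Fact quotient_scaleDr : right_distributive quotient_scale +%R.
Proof.
move=> a x y; have [u ->] := quotient_moduleP x; have [v ->] := quotient_moduleP y.
rewrite !pi_quotient_scale -!(raddfD (\pi_({ideal_quot I}))).
by rewrite pi_quotient_scale scalerDr.
Qed.

Fact quotient_scaleDl x : {morph quotient_scale^~ x : a b / a + b}.
Proof.
move=> a b /=; have [v ->] := quotient_moduleP x.
by rewrite !pi_quotient_scale scalerDl raddfD.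
Qed.

HB.instance Definition _ := GRing.Zmodule_isLmodule.Build A quotient_module
  quotient_scaleA quotient_scale1 quotient_scaleDr quotient_scaleDl.

End QuotientModule.

Section GeneratedIdeal.
Variables (A : comNzRingType) (G : A -> Prop).

(* The ideal generated by G: finite sums of a * g with g in G. *)
Definition generated_ideal : {pred A^o} := fun p =>
  `[< exists s : seq (A * A),
        (forall ag, ag \in s -> G ag.2) /\ p = \sum_(ag <- s) ag.1 * ag.2 >].

Fact generated_ideal_submod_closed : submod_closed generated_ideal.
Proof.
split=> [|a u v /asboolP[s [Gs ->]] /asboolP[r [Gr ->]]].
  by apply/asboolP; exists [::]; rewrite big_nil.
apply/asboolP; exists ([seq (a * x.1, x.2) | x <- s] ++ r); split.
  move=> x; rewrite mem_cat => /orP[/mapP[y ys ->]|]; last exact: Gr.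
  exact: (Gs _ ys).
rewrite big_cat big_map scaler_sumr /=; congr (_ + _).
by apply: eq_bigr => x _; rewrite -mulrA.
Qed.

End GeneratedIdeal.

Definition edge_monomial (K : fieldType) (n : nat) (e : rel 'I_n)
    (p : {mpoly K[n]}) : Prop :=
  exists i j : 'I_n, e i j /\ p = 'X_i * 'X_j.

(* R/I, with R = K[X_1, ..., X_n] and I the edge ideal of the graph e. *)
Definition edge_ring (K : fieldType) (n : nat) (e : rel 'I_n) :
    lmodType {mpoly K[n]} :=
  quotient_module (generated_ideal_submod_closed (@edge_monomial K n e)).

(* Oriented list of the edges of B_{2t}, with the vertices numbered from 1. *)
Definition B2t_arc (t i j : nat) : bool :=
  [&& 1 <= i <= 3 * t + 2, i != t + 1, i != 2 * t + 2 & j == i + 1]%N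
  || [&& 1 <= i <= 2 * t + 2 & j == i + t + 1]%N.

(* The vertex v_i is the ordinal i - 1. *)
Definition B2t (t : nat) : rel 'I_(3 * t + 3) :=
  fun u v => B2t_arc t u.+1 v.+1 || B2t_arc t v.+1 u.+1.

Lemma B2t_sym (t : nat) : ssrbool.symmetric (@B2t t).
Proof. by move=> u v; rewrite /B2t orbC. Qed.

Lemma B2t_irr (t : nat) : irreflexive (@B2t t).
Proof.
move=> u; rewrite /B2t orbb /B2t_arc.
have ne d : (u.+1 == u.+1 + d.+1)%N = false.
  by rewrite -[X in X == _]addn0 eqn_add2l.
by rewrite -addnA (ne 0%N) addn1 ne !andbF.
Qed.

(* Main.v *)
(** Upper bound: for a squarefree monomial ideal J generated by variables and
    edges, and an edge {x, y} none of whose ends lies in J, the exact sequence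
    0 -> R/(J : x) -> R/J -> R/(J, x) -> 0 has outer terms of the same kind
    with more variables; it terminates at ideals of variables, whose
    projective dimension is at most their number of generators.  So
    pd R/I <= 3t + 3.

    Lower bound: if S is independent, the product of its variables is a nonzero
    element of R/I killed by every variable with a neighbour in S.  The
    variables form a regular sequence on every projective module, so the number
    of such variables is at most the length of any projective resolution.  In the
    grid, one takes the smaller colour class of the bipartition and replaces the
    two neighbours of a corner by the corner, which leaves at least
    (3t + 4)/2 vertices adjacent to S. *)

Require Import Defs.
From HB Require Import structures.
From mathcomp Require Import all_boot all_order all_algebra.
From mathcomp Require Import boolp.
From mathcomp Require Import mpoly freeg.
From mathcomp Require Import zify lra.

Set Implicit Arguments.
Unset Strict Implicit.
Unset Printing Implicit Defensive.

Import Order.TTheory GRing.Theory Num.Theory.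

Local Open Scope ring_scope.
Local Open Scope quotient_scope.

(** * Projective dimension through syzygies *)

Lemma eq_pair (S T : Type) (x y : S * T) : x.1 = y.1 -> x.2 = y.2 -> x = y.
Proof. by case: x y => [a b] [c d] /= -> ->. Qed.

Section Submodule.
Variables (A : nzRingType) (V : lmodType A) (S : {pred V}).

(* The closure proof is an argument so that the module structure is inferred
   from the type. *)
Definition submodule of submod_closed S : Type := {v : V | v \in S}.

Hypothesis S_closed : submod_closed S.

HB.instance Definition _ := SubChoice.on (submodule S_closed).
HB.instance Definition _ :=
  GRing.SubChoice_isSubLmodule.Build A V S (submodule S_closed) S_closed.

End Submodule.

(** * Linear maps obtained from chosen preimages *)

Section LinearMaps.
Variable A : nzRingType.
Implicit Types K P M N V W : lmodType A.

Lemma linear_map V W (f : V -> W) :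
  linear f -> exists h : {linear V -> W}, forall v, h v = f v.
Proof.
move=> lin_f.
pose h : {linear V -> W} := HB.pack f (GRing.isLinear.Build A V W _ f lin_f).
by exists h.
Qed.

(** Preimages under [g] are chosen arbitrarily; the kernel condition makes [f] independent of the
    choice, and linearity follows. *)
Lemma linear_factor V M N (g : {linear V -> M}) (f : {linear V -> N}) :
    (forall y, exists v, g v = y) -> (forall v, g v = 0 -> f v = 0) ->
  exists h : {linear M -> N}, forall v, h (g v) = f v.
Proof.
move=> /choice[r rK] ker_gf.
have f_eq u v : g u = g v -> f u = f v.
  by move=> guv; apply/subr0_eq; rewrite -linearB ker_gf // linearB guv subrr.
have [a x y|h hE] := @linear_map _ _ (fun y => f (r y)).
  by rewrite -linearP; apply: f_eq; rewrite linearP !rK.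
by exists h => v; rewrite hE; apply: f_eq; rewrite rK.
Qed.

Lemma linear_lift K P V (i : {linear K -> P}) (f : {linear V -> P}) :
    injective i -> (forall v, exists k, i k = f v) ->
  exists h : {linear V -> K}, forall v, i (h v) = f v.
Proof.
move=> i_inj /choice[r rK].
have [a u v|h hE] := @linear_map _ _ r.
  by apply: i_inj; rewrite linearP !rK linearP.
by exists h => v; rewrite hE.
Qed.

Lemma linear_inj V W (f : {linear V -> W}) :
  (forall v, f v = 0 -> v = 0) -> injective f.
Proof. by move=> f0 u v fuv; apply/subr0_eq/f0; rewrite linearB fuv subrr. Qed.

Lemma ker_submod_closed V W (f : {linear V -> W}) :
  submod_closed [pred v | f v == 0].
Proof.
split=> [|a u v]; rewrite !inE ?linear0 // => /eqP fu /eqP fv.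
by rewrite linearP fu fv scaler0 addr0.
Qed.

End LinearMaps.

(** * Bounds along short exact sequences *)

Section ProjectiveDimension.
Variable A : nzRingType.
Implicit Types K P M N : lmodType A.

Definition short_exact K P M (i : {linear K -> P}) (g : {linear P -> M}) :=
  [/\ injective i, forall p, g p = 0 <-> exists k, i k = p
    & forall y, exists p, g p = y].

(** Recursion on one syzygy at a time replaces indexed complexes, so that bounds are proved by
    induction on [n]. *)
Fixpoint pd_le (n : nat) (M : lmodType A) : Prop :=
  if n is k.+1 then
    exists (P K : lmodType A) (i : {linear K -> P}) (g : {linear P -> M}),
      [/\ projective_module P, short_exact i g & pd_le k K]
  else projective_module M.

Lemma projective_trivial M : (forall x : M, x = 0) -> projective_module M.
Proof.
move=> M0 N N' g f _; exists (\0 : {linear M -> N}) => x.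
by rewrite (M0 x) !linear0.
Qed.

Lemma projective_prod P Q :
  projective_module P -> projective_module Q -> projective_module (P * Q)%type.
Proof.
move=> prP prQ M N g f g_surj.
have [f1 f1E] : exists h : {linear P -> N}, forall p, h p = f (p, 0).
  apply: linear_map => a u v; rewrite -linearP; congr (f _).
  by apply: eq_pair; rewrite /= ?scaler0 ?addr0.
have [f2 f2E] : exists h : {linear Q -> N}, forall p, h p = f (0, p).
  apply: linear_map => a u v; rewrite -linearP; congr (f _).
  by apply: eq_pair; rewrite /= ?scaler0 ?addr0.
have [h1 h1E] := prP _ _ g f1 g_surj; have [h2 h2E] := prQ _ _ g f2 g_surj.
have [|h hE] := @linear_map _ (P * Q)%type M (fun x => h1 x.1 + h2 x.2).
  by move=> a u v /=; rewrite !linearP scalerDr addrACA.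
exists h => -[p q]; rewrite hE linearD h1E h2E f1E f2E -linearD.
by congr (f _); apply: eq_pair; rewrite /= ?addr0 ?add0r.
Qed.

Lemma pd_leS n M : pd_le n M -> pd_le n.+1 M.
Proof.
elim: n M => [|n IHn] M; last first.
  by move=> [P [K [i [g [prP ig pdK]]]]]; exists P, K, i, g; split; auto.
move=> prM; exists M, 'rV[A]_0, \0, idfun; split=> //; last first.
  by apply: projective_trivial => x; apply/rowP => -[].
split=> [x y _|p|y]; [by apply/rowP => -[] | | by exists y].
by split=> [/= ->|[k <-] //]; exists 0.
Qed.

Lemma pd_le_leq m n M : (m <= n)%N -> pd_le m M -> pd_le n M.
Proof.
move=> /subnK <- pdM; elim: (n - m)%N => // k IHk.
exact: pd_leS.
Qed.

(** Horseshoe argument: projective presentations of [K] and [N] combine into one of [M], whose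
    syzygy is an extension of the two given syzygies. *)
Lemma pd_le_extension n K M N (i : {linear K -> M}) (g : {linear M -> N}) :
  short_exact i g -> pd_le n K -> pd_le n N -> pd_le n M.
Proof.
elim: n K M N i g => [|n IHn] K M N i g [i_inj gi g_surj].
  move=> prK prN V W q f q_surj.
  (* For [n = 0] the sequence splits by [s], with retraction [r], and a lift is built on each
     summand. *)
  have [s sE] := prN _ _ g idfun g_surj.
  have [r rE] : exists r : {linear M -> K}, forall x, i (r x) = x - s (g x).
    have [|e eE] := @linear_map _ M M (fun x => x - s (g x)).
      by move=> a u v; rewrite (linearP g) (linearP s) opprD addrACA scalerBr.
    have [v|r rE] := linear_lift (f := e) i_inj; last first.
      by exists r => x; rewrite rE eE.
    by apply/gi; rewrite eE linearB sE subrr.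
  have [h1 h1E] := prK _ _ q (f \o i) q_surj.
  have [h2 h2E] := prN _ _ q (f \o s) q_surj.
  exists ((h1 \o r) \+ (h2 \o g)) => x /=.
  by rewrite linearD h1E h2E /= rE -linearD subrK.
move=> [P1 [K1 [i1 [g1 [prP1 [i1_inj g1i1 g1_surj] pdK1]]]]].
move=> [P2 [K2 [i2 [g2 [prP2 [i2_inj g2i2 g2_surj] pdK2]]]]].
(* The lift [l] of [g2] through [g] makes [P1 * P2] surject onto [M]; [L] is the kernel. *)
have [l lE] := prP2 _ _ g g2 g_surj.
have gi0 k : g (i k) = 0 by apply/gi; exists k.
have [|q qE] := @linear_map _ (P1 * P2)%type M (fun x => i (g1 x.1) + l x.2).
  by move=> a u v /=; rewrite !linearP scalerDr addrACA.
pose L : lmodType A := submodule (ker_submod_closed q).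
have LP (x : L) : q (val x) = 0 by apply/eqP; exact: (valP x).
have inL x : q x = 0 -> exists y : L, val y = x.
  by move=> /eqP qx; exists (Sub x qx); rewrite SubK.
exists (P1 * P2)%type, L, val, q.
have ex_q : short_exact (val : {linear L -> (P1 * P2)%type}) q.
  split=> [|p|y]; first exact: val_inj.
    by split=> [/inL//|[k <-]]; apply: LP.
  have [p2 p2E] := g2_surj (g y).
  have /gi[k kE] : g (y - l p2) = 0 by rewrite linearB lE p2E subrr.
  have [p1 p1E] := g1_surj k.
  by exists (p1, p2); rewrite qE p1E kE subrK.
split=> //; first exact: projective_prod.
(* The maps [j] and [h] form the short exact sequence of syzygies 0 -> K1 -> L -> K2 -> 0. *)
have [j jE] : exists j : {linear K1 -> L}, forall k, val (j k) = (i1 k, 0).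
  have [|e eE] := @linear_map _ K1 (P1 * P2)%type (fun k => (i1 k, 0)).
    by move=> a u v; apply: eq_pair; rewrite /= ?linearP // scaler0 addr0.
  have [|v|j jE] := linear_lift (i := (val : {linear L -> (P1 * P2)%type}))
    (f := e); [exact: val_inj | | by exists j => k; rewrite jE eE].
  apply: inL; rewrite qE eE /= linear0 addr0.
  by have -> : g1 (i1 v) = 0 by [apply/g1i1; exists v]; rewrite linear0.
have [h hE] : exists h : {linear L -> K2}, forall x, i2 (h x) = (val x).2.
  have [|e eE] := @linear_map _ L P2 (fun x => (val x).2).
    by move=> a u v; rewrite linearP.
  have [v|h hE] := linear_lift (f := e) i2_inj; last first.
    by exists h => x; rewrite hE eE.
  apply/g2i2; rewrite eE -lE; have := congr1 g (LP v).
  by rewrite qE linearD gi0 add0r linear0.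
apply: (IHn _ _ _ j h) => //; split=> [x y jxy|x|y].
- by apply: i1_inj; have := congr1 val jxy; rewrite !jE => -[].
- split=> [hx|[k <-]]; last first.
    by apply: i2_inj; rewrite hE jE linear0.
  have x2 : (val x).2 = 0 by rewrite -hE hx linear0.
  have /g1i1[k kE] : g1 (val x).1 = 0.
    by apply: i_inj; have := LP x; rewrite qE x2 !linear0 addr0.
  by exists k; apply: val_inj; rewrite jE kE -x2; case: (val x).
- have /gi[k kE] : g (l (i2 y)) = 0 by rewrite lE; apply/g2i2; exists y.
  have [p pE] := g1_surj (- k).
  have [|x xE] := inL (p, i2 y).
    by rewrite qE /= pE linearN kE addNr.
  by exists x; apply: i2_inj; rewrite hE xE.
Qed.

(** A projective module [P] mapping onto [M] also maps onto [N], and the kernel [L] of the composite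
    is an extension of [K] by the syzygy [K1] of [M]. *)
Lemma pd_le_cokernel n K M N (i : {linear K -> M}) (g : {linear M -> N}) :
  short_exact i g -> pd_le n K -> pd_le n.+1 M -> pd_le n.+1 N.
Proof.
move=> [i_inj gi g_surj] pdK [P [K1 [i1 [g1 [prP [i1_inj g1i1 g1_surj] pdK1]]]]].
pose q : {linear P -> N} := g \o g1.
pose L : lmodType A := submodule (ker_submod_closed q).
have LP (x : L) : g (g1 (val x)) = 0 by apply/eqP; exact: (valP x).
have inL x : q x = 0 -> exists y : L, val y = x.
  by move=> /eqP qx; exists (Sub x qx); rewrite SubK.
exists P, L, val, q; split=> //.
  split=> [|p|y]; first exact: val_inj.
    by split=> [/inL//|[k <-]]; apply: LP.
  by have [m <-] := g_surj y; have [p <-] := g1_surj m; exists p.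
have g1i10 k : g1 (i1 k) = 0 by apply/g1i1; exists k.
have [j jE] : exists j : {linear K1 -> L}, forall k, val (j k) = i1 k.
  apply: (linear_lift (i := (val : {linear L -> P}))); first exact: val_inj.
  by move=> v; apply: inL; rewrite /= g1i10 linear0.
have [//|v|h hE] := linear_lift (i := i) (f := (g1 \o val : {linear L -> M})).
  by apply/gi/LP.
apply: (pd_le_extension (i := j) (g := h)) => //; split=> [x y jxy|x|y].
- by apply: i1_inj; rewrite -!jE jxy.
- split=> [hx|[k <-]]; last by apply: i_inj; rewrite hE /= jE g1i10 linear0.
  have /g1i1[k kE] : g1 (val x) = 0 by rewrite -[LHS]hE hx linear0.
  by exists k; apply: val_inj; rewrite jE.
- have [p pE] := g1_surj (i y).
  have [|x xE] := inL p; first by rewrite /= pE; apply/gi; exists y.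
  by exists x; apply: i_inj; rewrite hE /= xE.
Qed.

Lemma pd_le_resolution n M : pd_le n M -> has_projective_resolution M n.
Proof.
elim: n M => [|n IHn] M.
  move=> prM; exists (fun i => if i is 0%N then M else 'rV[A]_0).
  exists (fun i => \0), idfun.
  have triv (x : 'rV[A]_0) : x = 0 by apply/rowP => -[].
  split=> [[|i]||x|i x|[|i] _ x] //; first exact: projective_trivial.
  - by move=> y; exists y.
  - by split=> [/= ->|[z <-] //]; exists 0.
  - by split=> // _; exists 0; rewrite (triv x).
move=> [P [K [i [g [prP [i_inj gi g_surj] /IHn]]]]].
move=> [Q [d [aug [prQ aug_surj ex0 ex van]]]].
pose R k : lmodType A := if k is k'.+1 then Q k' else P.
(* The resolution of the syzygy is spliced to [P] in degree 0 through [i \o aug]. *)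
pose e k : {linear R k.+1 -> R k} :=
  match k return {linear R k.+1 -> R k} with
  | 0%N => i \o aug : {linear Q 0%N -> P}
  | k'.+1 => d k'
  end.
exists R, e, g.
split=> [[|k]|//|x|[|k] x|[|k]] //=.
- split=> [/gi[k <-]|[z <-]]; last by apply/gi; exists (aug z).
  by have [z <-] := aug_surj k; exists z.
- rewrite -ex0; split=> [|->]; last exact: linear0.
  by rewrite -[in X in X -> _](linear0 i) => /i_inj.
- exact: ex.
- exact: van.
Qed.

End ProjectiveDimension.

(** * Regular sequences and socles *)

Section RegularSequences.
Variable A : comNzRingType.

(* v lies in the submodule (x_1, ..., x_k) V, for C = [:: x_1; ...; x_k]. *)
Fixpoint in_span (C : seq A) (V : lmodType A) (v : V) : Prop :=
  if C is x :: C' then exists w, in_span C' (v - x *: w) else v = 0.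

(** Weak regularity of [s] on V / (C) V. Each entry treated moves into [C], and congruence modulo
    [in_span C] replaces quotient modules. *)
Fixpoint regular_seq (C s : seq A) (V : lmodType A) : Prop :=
  if s is x :: s' then
    (forall v : V, in_span C (x *: v) -> in_span C v) /\ regular_seq (x :: C) s' V
  else True.

Lemma in_span0 C (V : lmodType A) : in_span C (0 : V).
Proof. by elim: C => //= x C IHC; exists 0; rewrite scaler0 subr0. Qed.

Lemma in_spanP C (V : lmodType A) a (u v : V) :
  in_span C u -> in_span C v -> in_span C (a *: u + v).
Proof.
elim: C u v => [|x C IHC] u v /=; first by move=> -> ->; rewrite scaler0 addr0.
move=> [u' Cu] [v' Cv]; exists (a *: u' + v').
have -> : a *: u + v - x *: (a *: u' + v') = a *: (u - x *: u') + (v - x *: v').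
  by rewrite !scalerDr !scalerN opprD addrACA !scalerA mulrC.
exact: IHC.
Qed.

Lemma in_spanZ C (V : lmodType A) a (u : V) : in_span C u -> in_span C (a *: u).
Proof. by move=> Cu; rewrite -[_ *: u]addr0; apply: in_spanP (in_span0 _ _). Qed.

Lemma in_spanD C (V : lmodType A) (u v : V) :
  in_span C u -> in_span C v -> in_span C (u + v).
Proof. by move=> Cu Cv; rewrite -[u]scale1r; apply: in_spanP. Qed.

Lemma in_spanN C (V : lmodType A) (u : V) : in_span C u -> in_span C (- u).
Proof. by rewrite -scaleN1r; apply: in_spanZ. Qed.

Lemma in_span_linear C (V W : lmodType A) (f : {linear V -> W}) v :
  in_span C v -> in_span C (f v).
Proof.
elim: C v => [|x C IHC] v /=; first by move=> ->; rewrite linear0.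
by move=> [w Cw]; exists (f w); rewrite -linearZ -linearB; apply: IHC.
Qed.

Lemma in_span_cons C x (V : lmodType A) (v : V) :
  in_span C v -> in_span (x :: C) v.
Proof. by exists 0; rewrite scaler0 subr0. Qed.

Lemma in_span_scale_mem C x (V : lmodType A) (v : V) :
  x \in C -> in_span C (x *: v).
Proof.
elim: C => //= y C IHC; rewrite inE => /orP[/eqP <-|/IHC]; last exact: in_span_cons.
by exists v; rewrite subrr; apply: in_span0.
Qed.

(* The element p represents a class of M = coker (d 0) killed by s.  If x is the
   head of s and x p = d k, then k represents an element of Z / x Z killed by
   the tail of s, where Z = ker (P 0 -> M): pass to the shifted complex modulo x. *)
Lemma socle_eq0 (m : nat) (C s : seq A) (P : nat -> lmodType A)
    (d : forall i, {linear P i.+1 -> P i}) :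
    (forall i x, d i (d i.+1 x) = 0) ->
    (forall i p, in_span C (d i p) -> exists z, in_span C (p - d i.+1 z)) ->
    (forall i, regular_seq C s (P i)) ->
    (forall i, (m < i)%N -> forall x : P i, x = 0) ->
    (m < size s)%N ->
  forall p, (forall x, x \in s -> exists z, in_span C (x *: p - d 0%N z)) ->
  exists z, in_span C (p - d 0%N z).
Proof.
elim: m C s P d => [|m IHm] C [|x s] P d //= dd ex reg van szs p ann_p.
  (* Here [P 1] vanishes, so x p is zero modulo [C], and x is regular. *)
  exists 0; rewrite linear0 subr0; apply: (reg 0%N).1.
  have [z] := ann_p x (mem_head _ _).
  by rewrite (van 1%N _ z) // linear0 subr0.
have [k Ck] := ann_p x (mem_head _ _).
have [||||||k' [w Cw]] :=
  IHm (x :: C) s (fun i => P i.+1) (fun i => d i.+1) _ _ _ _ _ k.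
- by move=> i y; apply: dd.
(* Exactness modulo x: if d q is congruent to x r, then x kills d r modulo [C], so r is a cycle,
   hence a boundary d z, and q - x z is a cycle too. *)
- move=> i q [r Cr]; have [|z Cz] := ex i r.
    apply: (reg i).1.
    have := in_spanN (in_span_linear (d i) Cr).
    by rewrite linearB dd sub0r opprK linearZ.
  have [|u Cu] := ex i.+1 (q - x *: z).
    have := in_spanD Cr (in_spanZ x Cz).
    by rewrite scalerBr addrA subrK -linearZ -linearB.
  by exists u, z; rewrite addrAC.
- by move=> i; case: (reg i.+1).
- by move=> i mi y; apply: van.
- by [].
(* With y p = d l modulo [C], comparing x y p with y x p shows that y k - x l is a cycle, hence a
   boundary. *)
- move=> y ys; have [|l Cl] := ann_p y; first by rewrite inE ys orbT.
  have [|z Cz] := ex 0%N (y *: k - x *: l).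
    have -> : d 0%N (y *: k - x *: l) =
        x *: (y *: p - d 0%N l) - y *: (x *: p - d 0%N k).
      rewrite linearB 2!linearZ /= !scalerBr !scalerA (mulrC x y) opprB.
      by rewrite [RHS]addrC addrA subrK.
    exact: in_spanD (in_spanZ x Cl) (in_spanN (in_spanZ y Ck)).
  by exists z, l; rewrite addrAC.
(* Applying d to k = d k' + x w gives x p = x d w modulo [C], and x cancels. *)
exists w; apply: (reg 0%N).1.
have := in_spanD Ck (in_span_linear (d 0%N) Cw).
by rewrite !(linearB (d 0%N)) dd subr0 linearZ addrA subrK scalerBr.
Qed.

End RegularSequences.

(** * Variables as a regular sequence on projective modules *)

Section PolynomialRing.
Variables (K : fieldType) (n : nat).
Local Notation R := {mpoly K[n]}.

Let vars (c : seq 'I_n) : seq R := [seq 'X_i | i <- c].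

(** Its kernel is the ideal generated by the variables in [c], so membership in that ideal becomes
    an equation in a domain. *)
Definition kill_vars (c : seq 'I_n) : R -> R :=
  comp_mpoly [tuple (if i \in c then 0 else 'X_i) | i < n].

HB.instance Definition _ c := GRing.RMorphism.on (kill_vars c).

Lemma kill_varsX c i : kill_vars c 'X_i = if i \in c then 0 else 'X_i.
Proof. by rewrite /kill_vars comp_mpolyXU -tnth_nth tnth_mktuple. Qed.

(** The property passes to sums and products, so constants and variables suffice. *)
Lemma in_span_sub_kill_vars c (p : R) : in_span (vars c) (p - kill_vars c p : R^o).
Proof.
pose T (q : R) := in_span (vars c) (q - kill_vars c q : R^o).
have TD q r : T q -> T r -> T (q + r).
  by rewrite /T rmorphD opprD addrACA; apply: in_spanD.
have TM q r : T q -> T r -> T (q * r).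
  move=> Tq Tr; rewrite /T rmorphM.
  have -> : q * r - kill_vars c q * kill_vars c r =
     kill_vars c r *: (q - kill_vars c q : R^o) + q *: (r - kill_vars c r : R^o).
    rewrite /GRing.scale /= !mulrBr (mulrC _ q) (mulrC _ (kill_vars c q)).
    by rewrite [RHS]addrC addrA subrK.
  by apply: in_spanP => //; apply: in_spanZ.
have TC (a : K) : T a%:MP.
  by rewrite /T /kill_vars comp_mpolyC subrr; apply: in_span0.
have TX i : T 'X_i.
  rewrite /T kill_varsX; case: ifP => ic; last by rewrite subrr; apply: in_span0.
  rewrite subr0 -[X in in_span _ X]mulr1.
  by apply: (@in_span_scale_mem _ _ _ R^o); apply: map_f.
rewrite -/(T p) [p]mpolyE; apply: (big_ind T) => [|q r|m _]; [exact: (TC 0) | exact: TD |].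
rewrite -mul_mpolyC mpolyXE_id; apply: (TM); first exact: TC.
apply: (big_ind T) => [|q r|i _]; [exact: (TC 1) | exact: TM |].
by elim: (m i) => [|k IHk]; rewrite ?expr0 ?exprS; [exact: (TC 1) | exact: TM].
Qed.

Lemma kill_vars_in_span c c0 (p : R) :
  {subset c <= c0} -> in_span (vars c) (p : R^o) -> kill_vars c0 p = 0.
Proof.
elim: c p => [|i c IHc] p sub /=; first by move=> ->; rewrite rmorph0.
move=> [w Cw]; have : kill_vars c0 (p - 'X_i * w) = 0.
  by apply: IHc Cw => j jc; apply: sub; rewrite inE jc orbT.
by rewrite rmorphB rmorphM /= kill_varsX sub ?mem_head // mul0r subr0.
Qed.

(** The free module on the underlying set of [P] maps onto [P], and projectivity splits this map. *)
Lemma projective_retract (A : nzRingType) (P : lmodType A) :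
  projective_module P ->
  exists (i : {linear P -> {freeg P / A}}) (g : {linear {freeg P / A} -> P}),
    forall p, g (i p) = p.
Proof.
move=> prP.
have [|g gE] := @linear_map A {freeg P / A} P (fglift id).
  have add := lift_is_additive (id : P -> P).
  have lift0 : fglift (id : P -> P) 0 = 0 by rewrite -(subrr 0) add subrr.
  have addD : {morph fglift (id : P -> P) : u v / u + v}.
    move=> u v; have addN : fglift id (- v) = - fglift (id : P -> P) v.
      by rewrite -[- v]sub0r add lift0 sub0r.
    by rewrite -[v in LHS]opprK add addN opprK.
  move=> a u v; rewrite addD; congr (_ + _).
  rewrite -[in LHS](freeg_sumE u) -[in RHS](freeg_sumE u) scaler_sumr.
  rewrite !(big_morph _ addD lift0) scaler_sumr; apply: eq_bigr => x _.
  rewrite !liftU scalerA -[RHS](liftU id); congr fglift.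
  by apply/eqP/freeg_eqP => y; rewrite coeffZ !coeffU mulrA.
have [p|i iE] := prP _ _ g idfun; last by exists i, g.
by exists << p >>; rewrite gE liftU scale1r.
Qed.

(** Passing to a free module and then to coefficients reduces the claim to R. There [kill_vars c]
    fixes X_j for j outside [c], and R is a domain. *)
Lemma projective_regular (P : lmodType R) c s :
  projective_module P -> uniq (s ++ c) -> regular_seq (vars c) (vars s) P.
Proof.
move=> prP; have [i [g giK]] := projective_retract prP.
elim: s c => //= j s IHs c /andP[jNsc usc]; split; last first.
  by apply: (IHs (j :: c)); rewrite (uniq_catCA s [:: j] c) /= jNsc.
move=> v /(in_span_linear i); rewrite linearZ => iv.
suff : in_span (vars c) (i v) by move=> /(in_span_linear g); rewrite giK.
rewrite -[i v]freeg_sumE.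
have j_c : j \in c = false by apply: contraNF jNsc; rewrite mem_cat orbC => ->.
apply: (big_ind (fun f => in_span (vars c) f)) => [|x y|x _]; first exact: in_span0.
  exact: in_spanD.
have [|cf cfE] := @linear_map _ {freeg P / R} R^o (coeff x).
  by move=> a u w; rewrite coeffD coeffZ.
have [|b bE] := @linear_map _ R^o {freeg P / R} (fun a => << a *g x >>).
  move=> a u w; apply/eqP/freeg_eqP => y.
  by rewrite coeffD coeffZ !coeffU mulrDl mulrA.
rewrite -bE; apply: in_span_linear.
rewrite -[X in in_span _ X]subr0.
have <- : kill_vars c (coeff x (i v)) = 0; last exact: in_span_sub_kill_vars.
have := kill_vars_in_span (fun=> id) (in_span_linear cf iv).
rewrite cfE coeffZ rmorphM /= kill_varsX j_c => /eqP.
rewrite mulf_eq0 => /orP[|/eqP//].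
by move/eqP/(congr1 (mcoeff U_(j))); rewrite mcoeffX eqxx mcoeff0 => /eqP; rewrite oner_eq0.
Qed.

End PolynomialRing.

(** * Monomial ideals *)

Section CyclicModules.
Variable A : comNzRingType.

(** This is M = A/J up to isomorphism; [J] may be exchanged for any equivalent predicate. *)
Definition presents (J : A -> Prop) (M : lmodType A) : Prop :=
  exists2 g : {linear A^o -> M},
    forall y, exists a, g a = y & forall a, g a = 0 <-> J a.

Lemma presents_quotient (S : {pred A^o}) (S_closed : submod_closed S) :
  presents (fun a => a \in S) (quotient_module S_closed).
Proof.
(* The packed ideal repeats the one inside [quotient_module], so that the two quotient types are
   convertible. *)
pose I : zmodClosed A^o := HB.pack (S : A^o -> bool)
  (GRing.isZmodClosed.Build A^o S (GRing.submod_closedB S_closed)).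
pose pi (a : A^o) : quotient_module S_closed := \pi_({ideal_quot I}) a.
have [|g gE] := @linear_map A A^o (quotient_module S_closed) pi.
  move=> a u v; rewrite [a *: pi u](pi_quotient_scale S_closed).
  exact: (raddfD (\pi_({ideal_quot I}))).
exists g => [y|a].
  by have [v ->] := quotient_moduleP y; exists v; rewrite gE.
have piS : (a \in S) = (pi a == pi 0).
  by rewrite -[a in LHS]subr0; apply: (Quotient.idealrBE I a 0).
rewrite gE piS; split=> [->|/eqP ->]; last exact: (raddf0 (\pi_({ideal_quot I}))).
by apply/eqP/esym; exact: (raddf0 (\pi_({ideal_quot I}))).
Qed.

(** The hypotheses say J1 = (J2 : x) and J3 = J2 + (x). Multiplication by x descends to [i], the
    identity to [g]. *)
Lemma presents_short_exact (J1 J2 J3 : A -> Prop) (M1 M2 M3 : lmodType A) (x : A) :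
    presents J1 M1 -> presents J2 M2 -> presents J3 M3 ->
    (forall a, J1 a <-> J2 (x * a)) ->
    (forall a, J3 a <-> exists b, J2 (a - x * b)) ->
  exists (i : {linear M1 -> M2}) (g : {linear M2 -> M3}), short_exact i g.
Proof.
move=> [g1 g1_surj g1J] [g2 g2_surj g2J] [g3 g3_surj g3J] J1E J3E.
have J20 : J2 0 by apply/g2J; rewrite linear0.
have [|f fE] := @linear_map _ A^o M2 (fun a => g2 (x * a)).
  by move=> a u v; rewrite -linearP /= mulrDr /GRing.scale /= mulrCA.
have [v /g1J/J1E/g2J|i iE] := linear_factor (f := f) g1_surj; first by rewrite fE.
have [v /g2J J2v|g gE] := linear_factor (f := g3) g2_surj.
  by apply/g3J/J3E; exists 0; rewrite mulr0 subr0.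
exists i, g; split=> [|v|y]; last by have [a <-] := g3_surj y; exists (g2 a).
  apply: linear_inj => v; have [a <-] := g1_surj v.
  by rewrite iE fE => /g2J/J1E/g1J.
have [a <-] := g2_surj v; rewrite gE; split=> [/g3J/J3E[b Jb]|[k]].
  by exists (g1 b); rewrite iE fE; apply/esym/subr0_eq; rewrite -linearB; apply/g2J.
have [b <-] := g1_surj k; rewrite iE fE -gE => <-; rewrite gE.
by apply/g3J/J3E; exists b; rewrite subrr.
Qed.

Definition pd_ideal_le (n : nat) (J : A -> Prop) : Prop :=
  forall M, presents J M -> pd_le n M.

End CyclicModules.

(** * Ideals generated by variables and edges *)

Section MonomialIdeals.
Variables (K : fieldType) (n : nat).
Local Notation R := {mpoly K[n]}.
Implicit Types (U : pred 'X_{1..n}) (W : {set 'I_n}) (e : rel 'I_n).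

Definition upward_closed U := forall m m', U m -> U (m' + m)%MM.

(** Encoding the ideal by its exponents turns colons and added variables into operations on
    predicates. *)
Definition monomial_ideal U : {pred R^o} := fun p => all U (msupp p).

Lemma monomial_ideal_closed U : upward_closed U -> submod_closed (monomial_ideal U).
Proof.
move=> upU; split=> [|a p q /allP Up /allP Uq]; apply/allP => m.
  by rewrite msupp0.
move/msuppD_le; rewrite mem_cat => /orP[|/Uq//].
by move=> /msuppM_le/allpairsP[[m1 m2] /= [_ /Up Um2 ->]]; apply: upU.
Qed.

Lemma monomial_idealX U m c : U m -> c *: 'X_[m] \in monomial_ideal U.
Proof.
by move=> Um; apply/allP => m' /msuppZ_le; rewrite msuppX inE => /eqP ->.
Qed.

Lemma monomial_ideal_ind U (T : R -> Prop) :
    T 0 -> (forall p q, T p -> T q -> T (p + q)) ->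
    (forall c m, U m -> T (c *: 'X_[m])) ->
  forall p, p \in monomial_ideal U -> T p.
Proof.
move=> T0 TD TX p /allP Up; rewrite [p]mpolyE big_seq.
by apply: (big_ind T) => // m /Up; apply: TX.
Qed.

Section Step.
Variables (U U1 U3 : pred 'X_{1..n}) (x : 'I_n).
Hypotheses (upU : upward_closed U) (U1E : forall m, U1 m = U (U_(x) + m)%MM)
  (U3E : forall m, U3 m = U m || (0 < m x)%N).

Lemma upward_closed_colon : upward_closed U1.
Proof. by move=> m m'; rewrite !U1E addmA (addmC _ m') -addmA; apply: upU. Qed.

Lemma upward_closed_addvar : upward_closed U3.
Proof.
move=> m m'; rewrite !U3E => /orP[/(upU m')->//|mx].
by rewrite mnmDE addn_gt0 mx !orbT.
Qed.

Lemma monomial_ideal_colon (p : R) :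
  p \in monomial_ideal U1 <-> 'X_x * p \in monomial_ideal U.
Proof.
rewrite mulrC; split=> /allP H; apply/allP => m.
  by rewrite (perm_mem (msuppMX _ _)) => /mapP[m' /H + ->]; rewrite U1E.
move=> mp; rewrite U1E; apply: H.
by rewrite (perm_mem (msuppMX _ _)); apply: map_f.
Qed.

Lemma monomial_ideal_addvar (p : R) :
  p \in monomial_ideal U3 <-> exists q, p - 'X_x * q \in monomial_ideal U.
Proof.
have [clU0 clU] := monomial_ideal_closed upU.
split=> [|[q Uq]].
  move: p; apply: monomial_ideal_ind => [|p q [p' Up] [q' Uq]|c m].
  - by exists 0; rewrite mulr0 subr0.
  - exists (p' + q'); rewrite mulrDr opprD addrACA.
    by have := clU 1 _ _ Up Uq; rewrite scale1r.
  rewrite U3E => /orP[Um|mx].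
    by exists 0; rewrite mulr0 subr0; apply: monomial_idealX.
  exists (c *: 'X_[m - U_(x)]); rewrite -scalerAr -mpolyXD addmC submK ?subrr //.
  by apply/mnm_lepP => i; rewrite mnm1E; case: eqP => // <-.
apply/allP => m; rewrite -[p](subrK ('X_x * q)) => /msuppD_le.
rewrite mem_cat U3E => /orP[/(allP Uq)->//|].
rewrite mulrC (perm_mem (msuppMX _ _)) => /mapP[m' _ ->].
by rewrite mnmDE mnm1E eqxx orbT.
Qed.

Let J V (p : R) : Prop := p \in monomial_ideal V.

Lemma pd_monomial_ideal_step k :
  pd_ideal_le k (J U1) -> pd_ideal_le k (J U3) -> pd_ideal_le k (J U).
Proof.
move=> pd1 pd3 M presM.
have pres1 := presents_quotient (monomial_ideal_closed upward_closed_colon).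
have pres3 := presents_quotient (monomial_ideal_closed upward_closed_addvar).
have [i [g ig]] := presents_short_exact pres1 presM pres3
  monomial_ideal_colon monomial_ideal_addvar.
exact: pd_le_extension ig (pd1 _ pres1) (pd3 _ pres3).
Qed.

(** The same exact sequence, read for its cokernel; it handles ideals of variables. *)
Lemma pd_monomial_ideal_addvar k :
  pd_ideal_le k (J U1) -> pd_ideal_le k.+1 (J U) -> pd_ideal_le k.+1 (J U3).
Proof.
move=> pd1 pd2 M presM.
have pres1 := presents_quotient (monomial_ideal_closed upward_closed_colon).
have pres2 := presents_quotient (monomial_ideal_closed upU).
have [i [g ig]] := presents_short_exact pres1 pres2 presM
  monomial_ideal_colon monomial_ideal_addvar.
exact: pd_le_cokernel ig (pd1 _ pres1) (pd2 _ pres2).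
Qed.

End Step.

Lemma pd_ideal_0 : pd_ideal_le 0 (fun p : R => p = 0).
Proof.
move=> M [g g_surj g0] N1 N2 q f q_surj.
have [y yE] := q_surj (f (g 1)).
have [|h hE] := @linear_map _ R^o N1 (fun a => a *: y).
  by move=> a u v; rewrite scalerDl scalerA.
have [v /g0 ->|h' h'E] := linear_factor (f := h) g_surj; first exact: linear0.
exists h' => m; have [a <-] := g_surj m.
rewrite h'E hE linearZ /= yE -!linearZ; congr (f (g _)).
by rewrite /GRing.scale /= mulr1.
Qed.

Definition touches W : pred 'X_{1..n} := fun m => [exists i in W, (0 < m i)%N].

(** For irreflexive [e], these are the exponents in the ideal generated by the variables in [W] and
    the edges of [e]. *)
Definition edge_or_touches e W : pred 'X_{1..n} := fun m =>
  touches W m || [exists i, exists j, [&& e i j, (0 < m i)%N & (0 < m j)%N]].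

Lemma touches_upward_closed W : upward_closed (touches W).
Proof.
move=> m m' /existsP[i /andP[iW mi]]; apply/existsP; exists i.
by rewrite iW mnmDE addn_gt0 mi orbT.
Qed.

Lemma edge_or_touches_upward_closed e W : upward_closed (edge_or_touches e W).
Proof.
move=> m m' /orP[Wm|/existsP[i /existsP[j /and3P[eij mi mj]]]]; apply/orP.
  by left; apply: touches_upward_closed.
right; apply/existsP; exists i; apply/existsP; exists j.
by rewrite eij !mnmDE !addn_gt0 mi mj !orbT.
Qed.

Lemma touchesU1 x W m : touches (x |: W) m = touches W m || (0 < m x)%N.
Proof.
apply/existsP/orP => [[i]|[/existsP[i /andP[iW mi]]|mx]].
- rewrite !inE => /andP[/orP[/eqP ->|iW] mi]; first by right.
  by left; apply/existsP; exists i; rewrite iW.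
- by exists i; rewrite !inE iW orbT.
- by exists x; rewrite !inE eqxx.
Qed.

Lemma touchesX x W m : x \notin W -> touches W (U_(x) + m)%MM = touches W m.
Proof.
move=> xW; apply: eq_existsb => i; rewrite mnmDE mnm1E.
by case: (x =P i) => [<-|//]; rewrite (negbTE xW).
Qed.

(** The variables are added one by one. The colon by a new variable leaves the ideal unchanged, so
    each addition costs at most one. *)
Lemma pd_touches_ideal W :
  pd_ideal_le #|W| (fun p : R => p \in monomial_ideal (touches W)).
Proof.
move Ek : #|W| => k; elim: k W Ek => [|k IHk] W Ek.
  move: Ek => /eqP; rewrite cards_eq0 => /eqP -> M [g g_surj gE].
  apply: pd_ideal_0; exists g => // p; rewrite gE.
  split=> [/allP p0|->]; last by apply/allP => m; rewrite msupp0.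
  apply: msuppnil0; case: (msupp p) p0 => // m s /(_ m (mem_head _ _)).
  by case/existsP => i; rewrite inE.
have /card_gt0P[x xW] : (0 < #|W|)%N by rewrite Ek.
have xW' : x \notin W :\ x by rewrite !inE eqxx.
have Ek' : #|W :\ x| = k by move: Ek; rewrite (cardsD1 x) xW => -[].
have pd' := IHk _ Ek'.
apply: (pd_monomial_ideal_addvar (U := touches (W :\ x)) (x := x) _ _ _ pd').
- exact: touches_upward_closed.
- by move=> m; rewrite touchesX.
- by move=> m; rewrite -touchesU1 setD1K.
- by move=> M /pd'; apply: pd_leS.
Qed.

(** In the colon by x, every edge at x is reduced to its other end, so the neighbours of x join
    [W]. *)
Lemma edge_or_touchesX e x W m :
    ssrbool.symmetric e -> irreflexive e -> x \notin W ->
  edge_or_touches e (W :|: [set j | e x j]) m = edge_or_touches e W (U_(x) + m)%MM.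
Proof.
move=> e_sym e_irr xW; rewrite /edge_or_touches touchesX //.
apply/orP/orP => [[/existsP[i]|/existsP[i /existsP[j /and3P[eij mi mj]]]]|].
- rewrite !inE => /andP[/orP[iW|exi] mi]; first by left; apply/existsP; exists i; rewrite iW.
  right; apply/existsP; exists x; apply/existsP; exists i.
  by rewrite exi !mnmDE mnm1E eqxx !addn_gt0 mi orbT.
- right; apply/existsP; exists i; apply/existsP; exists j.
  by rewrite eij !mnmDE !addn_gt0 mi mj !orbT.
have ex_nbr j : e x j -> (0 < (U_(x) + m)%MM j)%N ->
    touches (W :|: [set j | e x j]) m.
  move=> exj; rewrite mnmDE mnm1E.
  case: (x =P j) => [xj|_ mj]; first by rewrite -xj e_irr in exj.
  by apply/existsP; exists j; rewrite !inE exj orbT.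
case=> [/existsP[i /andP[iW mi]]|/existsP[i /existsP[j /and3P[eij mi mj]]]].
  by left; apply/existsP; exists i; rewrite !inE iW.
have [ix|ix] := eqVneq x i; first by left; apply: (ex_nbr j) => //; rewrite ix.
have [jx|jx] := eqVneq x j; first by left; apply: (ex_nbr i) => //; rewrite e_sym jx.
right; apply/existsP; exists i; apply/existsP; exists j.
by move: mi mj; rewrite !mnmDE !mnm1E (negbTE ix) (negbTE jx) !add0n eij => -> ->.
Qed.

Lemma pd_edge_or_touches_ideal e W : ssrbool.symmetric e -> irreflexive e ->
  pd_ideal_le n (fun p : R => p \in monomial_ideal (edge_or_touches e W)).
Proof.
move=> e_sym e_irr.
have card_le W' : (#|W'| <= n)%N by rewrite -[X in (_ <= X)%N]card_ord max_card.
have card_lt k (W1 W2 : {set 'I_n}) y : W1 \subset W2 -> y \in W2 -> y \notin W1 ->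
    (n - #|W1| <= k.+1)%N -> (n - #|W2| <= k)%N.
  move=> W12 y2 y1; have : (#|W1| < #|W2|)%N.
    by apply: proper_card; apply/properP; split=> //; exists y.
  by have := card_le W1; lia.
(* When [V] is a vertex cover, the edge generators are redundant and only variables remain. *)
have pd_no_edge (V : {set 'I_n}) : (forall x y, e x y -> (x \in V) || (y \in V)) ->
    pd_ideal_le n (fun p : R => p \in monomial_ideal (edge_or_touches e V)).
  move=> coverV M [g g_surj gE].
  apply: (pd_le_leq (card_le V)); apply: pd_touches_ideal; exists g => // p.
  rewrite gE; suff -> : edge_or_touches e V = touches V by [].
  apply/funext => m; apply/orb_idr => /existsP[i /existsP[j /and3P[/coverV eij mi mj]]].
  by case/orP: eij => inV; apply/existsP; [exists i|exists j]; rewrite inV.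
(* Induction on a bound for the number of variables outside [W]: the colon by x adds at least y to
   [W], the other ideal adds x. *)
move: {2}(n - #|W|)%N (leqnn (n - #|W|)%N) => k.
elim: k W => [|k IHk] W leW.
  apply: pd_no_edge => x y _; suff -> : W = setT by rewrite inE.
  by apply/eqP; rewrite eqEcard subsetT cardsT card_ord -subn_eq0 -leqn0.
have [[x [y [exy xW yW]]]|noedge] :=
    pselect (exists x y, [/\ e x y, x \notin W & y \notin W]); last first.
  apply: pd_no_edge => x y exy; apply/orP; case: (boolP (x \in W)) => xW; first by left.
  by right; apply/negPn/negP => yW; apply: noedge; exists x, y.
have pdN := IHk (W :|: [set j | e x j]); have pdx := IHk (x |: W).
apply: (pd_monomial_ideal_step (x := x) _ _ _ (pdN _) (pdx _)).
- exact: edge_or_touches_upward_closed.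
- by move=> m; apply: edge_or_touchesX.
- by move=> m; rewrite /edge_or_touches touchesU1 orbAC.
- by apply: (card_lt _ _ _ y _ _ yW leW); rewrite ?subsetUl // !inE exy orbT.
- by apply: (card_lt _ _ _ x _ _ xW leW); rewrite ?subsetUr // !inE eqxx.
Qed.

End MonomialIdeals.

(** * Edge ideals and the grid *)

Section EdgeIdeals.
Variables (K : fieldType) (n : nat) (e : rel 'I_n).
Hypothesis e_irr : irreflexive e.
Local Notation R := {mpoly K[n]}.

Lemma generated_edge_ideal (p : R) :
  p \in generated_ideal (@edge_monomial K n e) <->
  p \in monomial_ideal (edge_or_touches e set0).
Proof.
have [clU0 clU] := @monomial_ideal_closed K _ _ (@edge_or_touches_upward_closed n e set0).
have [clG0 clG] := generated_ideal_submod_closed (@edge_monomial K n e).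
split=> [/asboolP[s [Gs ->]]|].
  rewrite big_seq; apply: (big_ind (fun q => q \in monomial_ideal _)) => // [x y Ux Uy|x /Gs].
    by have := clU 1 _ _ Ux Uy; rewrite scale1r.
  move=> [i [j [eij ->]]]; have := clU x.1 ('X_i * 'X_j) 0; rewrite addr0; apply=> //.
  rewrite -mpolyXD -['X_[_]]scale1r; apply: monomial_idealX; apply/orP; right.
  apply/existsP; exists i; apply/existsP; exists j.
  by rewrite eij !mnmDE !mnm1E !eqxx !addn_gt0 !orbT.
move: p; apply: monomial_ideal_ind => // [x y Gx Gy|c m].
  by have := clG 1 _ _ Gx Gy; rewrite scale1r.
case/orP=> [/existsP[i]|/existsP[i /existsP[j /and3P[eij mi mj]]]]; first by rewrite inE.
apply/asboolP; exists [:: (c *: 'X_[m - (U_(i) + U_(j))], 'X_i * 'X_j)]; split.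
  by move=> ag; rewrite inE => /eqP ->; exists i, j.
rewrite big_seq1 /= -mpolyXD -scalerAl -mpolyXD submK //.
apply/mnm_lepP => k; rewrite mnmDE !mnm1E.
(* A loop would require exponent 2 at i, whereas only positivity is known. *)
have ij : i != j by apply: contraTneq eij => ->; rewrite e_irr.
case: (i =P k) => [ik|_]; case: (j =P k) => [jk|_] //.
- by rewrite ik jk eqxx in ij.
- by rewrite -ik.
- by rewrite -jk.
Qed.

Lemma edge_ring_presents :
  presents (fun p : R => p \in monomial_ideal (edge_or_touches e set0)) (edge_ring K e).
Proof.
have [g g_surj gE] := presents_quotient
  (generated_ideal_submod_closed (@edge_monomial K n e)).
by exists g => // p; rewrite gE; apply: generated_edge_ideal.
Qed.

Lemma edge_ring_resolution :
  ssrbool.symmetric e -> has_projective_resolution (edge_ring K e) n.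
Proof.
move=> e_sym; apply: pd_le_resolution.
exact: pd_edge_or_touches_ideal e_sym e_irr _ edge_ring_presents.
Qed.

(** If [m < size s], then [socle_eq0] with empty [C] makes the monomial of [S] vanish in R/I,
    although no edge divides it. *)
Lemma resolution_length_ge (S : {set 'I_n}) (s : seq 'I_n) m :
    {in S &, forall x y, ~~ e x y} -> uniq s ->
    (forall x, x \in s -> exists2 y, y \in S & e x y) ->
  has_projective_resolution (edge_ring K e) m -> (size s <= m)%N.
Proof.
move=> S_indep s_uniq s_adj [P [d [aug [prP aug_surj ex0 ex van]]]].
rewrite leqNgt; apply/negP => ms.
have [g g_surj gE] := edge_ring_presents.
pose mS : 'X_{1..n} := [multinom (i \in S : nat) | i < n].
have [p pE] := aug_surj (g 'X_[mS]).
have [||||||z] := @socle_eq0 _ m [::] [seq 'X_i | i <- s] P d _ _ _ _ _ p.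
- by move=> i x; apply/ex; exists x.
- by move=> i q /ex[z <-]; exists z; rewrite subrr.
- by move=> i; apply: (@projective_regular K n _ [::]); rewrite ?cats0.
- exact: van.
- by rewrite size_map.
- move=> _ /mapP[x xs ->].
  have /ex0[z <-] : aug ('X_x *: p) = 0; last by exists z; rewrite subrr.
  rewrite linearZ /= pE -linearZ; apply/gE; rewrite /GRing.scale /= -mpolyXD -['X_[_]]scale1r.
  apply: monomial_idealX; have [y yS exy] := s_adj x xs; apply/orP; right.
  apply/existsP; exists x; apply/existsP; exists y.
  by rewrite exy !mnmDE !mnm1E !mnmE eqxx yS addn1.
move=> /= /subr0_eq pz.
have /gE/allP/(_ mS) : g 'X_[mS] = 0 by rewrite -pE; apply/ex0; exists z.
rewrite msuppX mem_head => /(_ isT)/orP[/existsP[i]|]; first by rewrite inE.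
move=> /existsP[i /existsP[j /and3P[eij]]]; rewrite !mnmE.
case iS: (i \in S); case jS: (j \in S) => // _ _; move: eij.
by rewrite (negbTE (S_indep _ _ iS jS)).
Qed.

End EdgeIdeals.

(** * Adjacency in the grid *)

Section Grid.
Variable t : nat.
Hypothesis t_gt0 : (0 < t)%N.
Local Notation n := (3 * t + 3)%N.

(* Column-major numbering of the grid, which makes the colour classes of the
   bipartition the two parity classes. *)
Definition column_index (i : nat) : nat := (3 * (i %% t.+1) + i %/ t.+1)%N.

Lemma column_indexE r c : (c < t.+1)%N -> column_index (r * t.+1 + c) = (3 * c + r)%N.
Proof.
by move=> ct; rewrite /column_index modnMDl modn_small // divnMDl // divn_small // addn0.
Qed.

Lemma column_indexP i : (i < n)%N -> exists r c,
  [/\ (r < 3)%N, (c < t.+1)%N, i = (r * t.+1 + c)%N & column_index i = (3 * c + r)%N].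
Proof.
move=> i_n; exists (i %/ t.+1)%N, (i %% t.+1)%N; split=> //.
- by rewrite ltn_divLR //; lia.
- by rewrite ltn_mod.
- exact: divn_eq.
Qed.

(** Vertical edges shift the index by 1, horizontal ones by 3. The converse fails: a shift by 1 may
    lead to the next column. *)
Lemma B2t_column_index (u v : 'I_n) : B2t u v ->
  [\/ column_index u = column_index v + 1, column_index v = column_index u + 1,
      column_index u = column_index v + 3 | column_index v = column_index u + 3]%N.
Proof.
have [r [c [r3 ct uE ->]]] := column_indexP (ltn_ord u).
have [r' [c' [r3' ct' vE ->]]] := column_indexP (ltn_ord v).
rewrite /B2t /B2t_arc uE vE => uv.
have /or4P : [|| 3 * c + r == 3 * c' + r' + 1, 3 * c' + r' == 3 * c + r + 1,
   3 * c + r == 3 * c' + r' + 3 | 3 * c' + r' == 3 * c + r + 3]%N.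
  by case: r r3 uv {uE} => [|[|[|]]] // _; case: r' r3' {vE} => [|[|[|]]] // _; lia.
by case=> /eqP->; [constructor 1 | constructor 2 | constructor 3 | constructor 4].
Qed.

(** Inverse of [column_index] on indices below [n], where the default ordinal 0 is never invoked. *)
Definition column_vertex (k : nat) : 'I_n :=
  insubd (Ordinal (ltn_addl (3 * t) (isT : 0 < 3)%N))
    (k %% 3 * t.+1 + k %/ 3)%N.

Lemma column_vertexE k : (k < n)%N ->
  val (column_vertex k) = (k %% 3 * t.+1 + k %/ 3)%N.
Proof.
move=> k_n; have kt : (k %/ 3 < t.+1)%N by rewrite ltn_divLR //; lia.
rewrite val_insubd ifT //.
have : (k %% 3 < 3)%N by rewrite ltn_mod.
by case: (k %% 3)%N => [|[|[|]]] //; lia.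
Qed.

Lemma column_vertexK k : (k < n)%N -> column_index (column_vertex k) = k.
Proof.
move=> k_n; rewrite column_vertexE // column_indexE; first by rewrite mulnC -divn_eq.
by rewrite ltn_divLR //; lia.
Qed.

Lemma B2t_horizontal k : (k + 3 < n)%N -> B2t (column_vertex k) (column_vertex (k + 3)).
Proof.
move=> k_n; rewrite /B2t /B2t_arc !column_vertexE //; last by lia.
have : (k %% 3 < 3)%N by rewrite ltn_mod.
rewrite modnDr divnDr // divnn /=.
have : (k %/ 3 < t)%N by rewrite ltn_divLR //; lia.
by case: (k %% 3)%N => [|[|[|]]] //; lia.
Qed.

Lemma B2t_vertical k : (k + 1 < n)%N -> (k %% 3 != 2)%N ->
  B2t (column_vertex k) (column_vertex (k + 1)).
Proof.
move=> k_n k3; rewrite /B2t /B2t_arc !column_vertexE //; last by lia.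
have -> : ((k + 1) %% 3 = k %% 3 + 1)%N by lia.
have -> : ((k + 1) %/ 3 = k %/ 3)%N by lia.
have : (k %% 3 < 3)%N by rewrite ltn_mod.
have : (k %/ 3 < t.+1)%N by rewrite ltn_divLR //; lia.
by case: (k %% 3)%N k3 => [|[|[|]]] //; lia.
Qed.

(* In column-major numbering, S is the colour class missing the last corner
   n - 1, with the two neighbours n - 2 and n - 4 of that corner replaced by the
   corner itself. *)
Lemma B2t_independent_dominating :
  exists (S : {set 'I_n}) (s : seq 'I_n),
    [/\ {in S &, forall x y, ~~ B2t x y}, uniq s,
        forall x, x \in s -> exists2 y, y \in S & B2t x y
      & (3 * t + 4 <= 2 * size s)%N].
Proof.
(* The bound [k + 6 <= n] drops exactly n - 2 and n - 4 from the class. *)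
pose inS (k : nat) := (k == n - 1)%N || ((k + 6 <= n)%N && ~~ odd (n - k)).
(* The two neighbours of the corner, followed by the whole opposite class without the corner. *)
pose ks := [:: n - 2, n - 4 & [seq n - 3 - 2 * j | j <- iota 0 (n - 1)./2]]%N.
have ksP (k : nat) : k \in ks -> (k < n)%N /\
    [\/ k = n - 2, k = n - 4 | exists2 j, j < (n - 1)./2 & k = n - 3 - 2 * j]%N.
  rewrite !inE => /or3P[/eqP->|/eqP->|/mapP[j]].
  - by split; [lia | constructor 1].
  - by split; [lia | constructor 2].
  - by rewrite mem_iota => /andP[_ jn] ->; split; [lia | constructor 3; exists j].
exists [set i : 'I_n | inS (column_index i)], [seq column_vertex k | k <- ks]; split.
(* Shifts by 1 or 3 change parity and are too short to reach n - 1 from an index at most n - 6. *)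
- move=> x y; rewrite !inE /inS => xS yS; apply/negP => /B2t_column_index.
  by move=> [] E; move: xS yS; rewrite E; lia.
- rewrite map_inj_in_uniq.
    rewrite /= !inE !negb_or; apply/and3P; split.
    + apply/andP; split; first by lia.
      by apply/mapP => -[j]; lia.
    + by apply/mapP => -[j]; rewrite mem_iota; lia.
    + rewrite map_inj_in_uniq ?iota_uniq // => i j; rewrite !mem_iota; lia.
  move=> k l /ksP[kn _] /ksP[ln _] /(congr1 (column_index \o val)) /=.
  by rewrite !column_vertexK.
- move=> _ /mapP[k /ksP[kn kE] ->].
  have adj l : (l < n)%N -> inS l -> B2t (column_vertex k) (column_vertex l) ->
      exists2 y, y \in [set i : 'I_n | inS (column_index i)] & B2t (column_vertex k) y.
    by move=> ln Sl kl; exists (column_vertex l); rewrite // inE column_vertexK.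
  case: kE => [kE|kE|[j jn kE]].
  + apply: (adj (k + 1)%N); [lia | by rewrite /inS; lia | apply: B2t_vertical; lia].
  + apply: (adj (k + 3)%N); [lia | by rewrite /inS; lia | apply: B2t_horizontal; lia].
  (* The neighbour in the preceding column serves outside the first column; inside it, a vertical
     neighbour does. *)
  have [k3|k3] := leqP 3 k.
    apply: (adj (k - 3)%N); [lia | by rewrite /inS; lia |].
    by rewrite B2t_sym -[in X in B2t _ X](subnK k3) B2t_horizontal //; lia.
  have [k0|k0] := posnP k.
    by apply: (adj (k + 1)%N); [lia | by rewrite /inS; lia | apply: B2t_vertical; lia].
  apply: (adj (k - 1)%N); [lia | by rewrite /inS; lia |].
  by rewrite B2t_sym -[in X in B2t _ X](subnK k0) B2t_vertical //; lia.
- by rewrite size_map /= size_map size_iota; lia.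
Qed.

End Grid.

Theorem proposition3p6 (K : fieldType) (t r : nat) (ht : (1 <= t)%N)
    (hr : r = (2 * t)%N) :
  exists pd : nat,
    [/\ is_projective_dimension (edge_ring K (@B2t t)) pd,
        odd t -> 3 / 4 * r%:R + 3 / 2 < pd%:R :> rat
                 /\ pd%:R <= 3 / 2 * r%:R + 3 :> rat
      & ~~ odd t -> 3 / 4 * r%:R + 1 < pd%:R :> rat
                    /\ pd%:R <= 3 / 2 * r%:R + 3 :> rat].
Proof.
have res := edge_ring_resolution K (@B2t_irr t) (@B2t_sym t).
have ex_res : exists k, `[< has_projective_resolution (edge_ring K (@B2t t)) k >].
  by exists (3 * t + 3)%N; apply/asboolP.
have [pd /asboolP pd_res pd_min] := ex_minnP ex_res.
have pd_dim : is_projective_dimension (edge_ring K (@B2t t)) pd.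
  by split=> // k /asboolP; apply: pd_min.
have le_pd : pd%:R <= 3 * t%:R + 3 :> rat.
  have : (pd <= 3 * t + 3)%N by apply: pd_min; apply/asboolP.
  by rewrite -(ler_nat rat) natrD natrM.
(* Twice the claimed strict bounds is 3t + 3 for odd t and 3t + 2 for even t, so this inequality
   settles both parities. *)
have ge_pd : 3 * t%:R + 4 <= 2 * pd%:R :> rat.
  have [S [s [S_indep s_uniq s_adj]]] := B2t_independent_dominating ht.
  move/leq_trans/(_ (leq_mul (leqnn 2) (resolution_length_ge (@B2t_irr t)
    S_indep s_uniq s_adj pd_res))).
  by rewrite -(ler_nat rat) natrD !natrM.
by exists pd; rewrite hr natrM; split=> // _; split; lra.
Qed.
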